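(* The sequence $\{\hat\lambda_k : k=2,3,\dots\}$ is strictly decreasing in $k$; that is, $\hat\lambda_{k+1}<\hat\lambda_k$ for every integer $k\ge2$.
   Context: For an integer $k\ge1$ and a real $\lambda>0$, the Poisson distribution of order $k$ with parameter $\lambda$ is the distribution on $\{0,1,2,\dots\}$ with probability mass function $$f_k(n;\lambda)=e^{-k\lambda}\sum_{n_1+2n_2+\dots+kn_k=n}\frac{\lambda^{n_1+\dots+n_k}}{n_1!\cdots n_k!},\qquad n=0,1,2,\dots,$$ where the sum is over all tuples $(n_1,\dots,n_k)$ of nonnegative integers with $n_1+2n_2+\dots+kn_k=n$. A mode is a location of a global maximum of $n\mapsto f_k(n;\lambda)$ over $n\ge0$; modes need not be unique. For $k\ge2$, $\hat\lambda_k$ denotes the smallest value of $\lambda>0$ for which $0$ and some integer $m>0$ are both modes of the Poisson distribution of order $k$ with parameter $\lambda$ (the first double mode; the possibility of further modes at $\lambda=\hat\lambda_k$ is not excluded by the definition). *)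

(* Defs.v *)
From HB Require Import structures.
From mathcomp Require Import all_boot all_order all_algebra.
From mathcomp Require Import all_classical all_reals all_analysis.

Set Implicit Arguments.
Unset Strict Implicit.
Unset Printing Implicit Defensive.

Import Order.TTheory GRing.Theory Num.Theory.

Local Open Scope classical_set_scope.
Local Open Scope ring_scope.

(* A tuple (n_1, ..., n_k) is encoded as t with t j = n_(j+1), for j < k.
   Bounding the entries by n loses no tuple of weight n: see [weight_bound]. *)
Definition poisson_weight (k n : nat) (t : {ffun 'I_k -> 'I_n.+1}) : nat :=
  (\sum_(j < k) j.+1 * t j)%N.

Lemma weight_bound (k n : nat) (t : 'I_k -> nat) :
  (\sum_(j < k) j.+1 * t j)%N = n -> forall j, (t j < n.+1)%N.
Proof.
move=> <- j; rewrite ltnS (bigD1 j) //=.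
by apply: leq_trans (leq_addr _ _); rewrite leq_pmull.
Qed.

Definition poisson_pmf (R : realType) (k : nat) (lambda : R) (n : nat) : R :=
  expR (- (k%:R * lambda)) *
  \sum_(t : {ffun 'I_k -> 'I_n.+1} | poisson_weight t == n)
    (lambda ^+ (\sum_(j < k) t j)%N / (\prod_(j < k) (t j)`!)%N%:R).

Definition is_mode (R : realType) (k : nat) (lambda : R) (m : nat) : Prop :=
  forall n : nat, poisson_pmf k lambda n <= poisson_pmf k lambda m.

Definition double_modes (R : realType) (k : nat) : set R :=
  [set lambda | [/\ 0 < lambda, is_mode k lambda 0 &
     exists2 m : nat, (0 < m)%N & is_mode k lambda m]].

Arguments double_modes R k : clear implicits.

Definition is_smallest (R : realType) (A : set R) (x : R) : Prop :=
  A x /\ lbound A x.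

(* The smallest element of [double_modes R k]; 0 is a dummy value, taken only
   if there is no such element. *)
Definition hat_lambda (R : realType) (k : nat) : R :=
  xget 0 [set lambda | is_smallest (double_modes R k) lambda].

(* Main.v *)
Require Import Defs.
From mathcomp Require Import all_boot all_order all_algebra.
From mathcomp Require Import all_classical all_reals all_analysis.
From mathcomp Require Import ring lra.

Import Order.TTheory GRing.Theory Num.Theory.

Local Open Scope ring_scope.

(** Dropping the factor [exp(-k x)], which does not depend on [n], leaves the
    coefficients [g_k(n)] of [exp(x (z + ... + z^k))], with [g_k(0) = 1]. Each
    [g_k(n)], [n > 0], increases strictly with [x], so an [x] at which 0 and
    some [m > 0] are modes is unique: it is the least root of the equations
    [g_k(n) = 1]. Only [n <= k^2] matter for it: when [x <= 1], the
    recurrence [n g_k(n) = x (1 g_k(n-1) + ... + k g_k(n-k))] propagates the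
    bound [g_k <= 1] beyond [k^2].
    Suppose [g_k(m) = 1] at [x]. If [m > k], the tuples using a part [k+1] give
    [g_(k+1)(m) > g_k(m) = 1]. If [m <= k], then [g_(k+1)(m) = g_k(m)], and
    [g_(k+1)] increases strictly on [1, ..., k+1], so [g_(k+1)(m+1) > 1].
    Either way 0 is no longer a mode of order [k+1] at [x], and the double mode
    of order [k+1] occurs earlier. *)

(** * Truncated generating functions and the recurrence *)

Definition weight_sum {F : fieldType} (k : nat) (x : F) (n : nat) : F :=
  \sum_(t : {ffun 'I_k -> 'I_n.+1} | poisson_weight t == n)
    (x ^+ (\sum_(j < k) t j)%N / (\prod_(j < k) (t j)`!)%N%:R).

(** Polynomial stand-in for the power series of exp(x z^(j+1)), cut after its term of index [N]; the
    factor [j] accounts for parts of size j+1. *)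
Definition trunc_exp {F : fieldType} (x : F) (N j : nat) : {poly F} :=
  \sum_(a < N.+1) (x ^+ a / a`!%:R) *: 'X^(j.+1 * a).

Definition trunc_gf {F : fieldType} (x : F) (N k : nat) : {poly F} :=
  \prod_(j < k) trunc_exp x N j.

Definition eqmodX {F : fieldType} (n : nat) (p q : {poly F}) :=
  forall m, (m < n)%N -> p`_m = q`_m.

Section Recurrence.
Context {F : numFieldType}.
Implicit Types (x : F) (p q : {poly F}) (k n N : nat).

Lemma eqmodX_mul n p p' q q' :
  eqmodX n p q -> eqmodX n p' q' -> eqmodX n (p * p') (q * q').
Proof.
move=> pq pq' m mn; rewrite !coefM; apply: eq_bigr => i _.
rewrite pq ?pq' //; first exact: leq_ltn_trans (leq_subr _ _) mn.
by apply: leq_ltn_trans mn; rewrite -ltnS.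
Qed.

Lemma coef_trunc_exp x N j n : (n <= N)%N ->
  (trunc_exp x N j)`_n = (trunc_exp x n j)`_n.
Proof.
move=> nN; rewrite /trunc_exp !coef_sum.
rewrite [RHS](big_ord_widen N.+1
  (fun a => ((x ^+ a / a`!%:R) *: 'X^(j.+1 * a))`_n)) //.
rewrite [RHS]big_mkcond; apply: eq_bigr => a _.
case: ltnP => // na; rewrite coefZ coefXn ltn_eqF ?mulr0 //.
by apply: leq_trans na _; rewrite leq_pmull.
Qed.

(** Expanding the product, a choice of one term in each factor is a tuple, and its degree in z is
    the weight. Terms of index above [n] have degree above [n], so any cutoff [N >= n] gives the
    same coefficient. *)
Lemma coef_trunc_gf k x N n : (n <= N)%N ->
  (trunc_gf x N k)`_n = weight_sum k x n.
Proof.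
move=> nN; transitivity ((trunc_gf x n k)`_n).
  suff: eqmodX n.+1 (trunc_gf x N k) (trunc_gf x n k) by apply.
  apply: (big_ind2 (eqmodX n.+1)) => // [p p' q q'|j _ m].
    exact: eqmodX_mul.
  rewrite ltnS => mn; rewrite coef_trunc_exp ?[RHS]coef_trunc_exp //.
  exact: leq_trans nN.
rewrite /trunc_gf bigA_distr_bigA coef_sum /weight_sum [RHS]big_mkcond /=.
apply: eq_bigr => t _.
rewrite scaler_prod prodrXr coefZ coefXn eq_sym -/(poisson_weight t).
case: eqP => _; last by rewrite mulr0.
by rewrite mulr1 prodf_div prodrXr natr_prod.
Qed.

Lemma deriv_trunc_exp x N j :
  (trunc_exp x N.+1 j)^`() = (x * j.+1%:R) *: ('X^j * trunc_exp x N j).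
Proof.
rewrite /trunc_exp big_ord_recl /= muln0 derivD derivZ expr0 derivC scaler0 add0r.
rewrite raddf_sum /= mulr_sumr scaler_sumr; apply: eq_bigr => a _.
rewrite derivZ derivXn -scalerAr scalerA -exprD /bump /= add1n.
rewrite -scaler_nat scalerA mulnS /= factS exprS; congr (_ *: 'X^_).
have a0 : a.+1%:R != 0 :> F by rewrite pnatr_eq0.
have f0 : a`!%:R != 0 :> F by rewrite pnatr_eq0 -lt0n fact_gt0.
rewrite -mulnS !natrM.
  by field; rewrite f0 addrC natr1.
by rewrite -[LHS]/(a + j * a.+1)%N mulnS mulSn addnCA.
Qed.

(** Truncated form of G' = x (1 + 2z + ... + k z^(k-1)) G for G = exp(x (z + ... + z^k)); comparing
    coefficients gives the recurrence. *)
Lemma deriv_trunc_gf k x N :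
  eqmodX N (trunc_gf x N k)^`()
    ((\sum_(j < k) (x * j.+1%:R) *: 'X^j) * trunc_gf x N k).
Proof.
case: N => [//|N]; elim: k => [|k IH].
  by rewrite /trunc_gf !big_ord0 derivC mul0r.
rewrite /trunc_gf big_ord_recr /= -/(trunc_gf x N.+1 k) derivM big_ord_recr /=.
rewrite mulrDl => m mN; rewrite coefD [RHS]coefD; congr (_ + _).
  by rewrite mulrA; apply: eqmodX_mul mN.
rewrite mulrCA deriv_trunc_exp -scalerAl; apply: eqmodX_mul mN => // {}m mN.
(* Differentiation lowered the cutoff by one, which does not affect coefficients of degree at most
   [N]. *)
rewrite !coefZ !coefXnM; case: ltnP => // jm.
have mjN : (m - k <= N)%N by rewrite (leq_trans (leq_subr _ _)).
by rewrite coef_trunc_exp // [in RHS]coef_trunc_exp // leqW.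
Qed.

Lemma weight_sum_rec k x n :
  n.+1%:R * weight_sum k x n.+1 =
  x * \sum_(j < k | (j <= n)%N) j.+1%:R * weight_sum k x (n - j).
Proof.
rewrite -(@coef_trunc_gf k x n.+1) // mulr_natl -coef_deriv.
rewrite deriv_trunc_gf // mulr_suml coef_sum mulr_sumr [RHS]big_mkcond /=.
apply: eq_bigr => j _; rewrite -scalerAl coefZ coefXnM ltnNge.
case: leqP => jn /=; last by rewrite mulr0.
by rewrite coef_trunc_gf ?mulrA // leqW // leq_subr.
Qed.

Lemma weight_sumE0 k x : weight_sum k x 0 = 1.
Proof.
rewrite -(@coef_trunc_gf k x 0) // /trunc_gf.
elim/big_rec: _ => [|j p _ p0]; first by rewrite coef1.
rewrite coefM big_ord1 subn0 p0 mulr1 /trunc_exp big_ord1 muln0 coefZ coefXn.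
by rewrite expr0 fact0 divr1 mulr1.
Qed.

(** Splits off the factor of the generating function that belongs to parts of size k+1. *)
Lemma weight_sum_recr k x n :
  weight_sum k.+1 x n =
  \sum_(i < n.+1) weight_sum k x (n - i) * (trunc_exp x n k)`_i.
Proof.
rewrite -(@coef_trunc_gf k.+1 x n) // /trunc_gf big_ord_recr /=.
rewrite coefMr; apply: eq_bigr => i _.
by rewrite -/(trunc_gf x n k) coef_trunc_gf // leq_subr.
Qed.
End Recurrence.

(** * Bounds and monotonicity in the parameter *)

Section Order.
Context {F : realFieldType}.
Implicit Types (x y : F) (k n N : nat).

Lemma weight_sum_ge0 k x n : 0 <= x -> 0 <= weight_sum k x n.
Proof.
by move=> x0; apply: sumr_ge0 => t _; rewrite divr_ge0 ?exprn_ge0.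
Qed.

(** Only the term [j = 0] of the recurrence is kept. *)
Lemma weight_sum_ge_pred k x n : (0 < k)%N -> 0 <= x ->
  x * weight_sum k x n <= n.+1%:R * weight_sum k x n.+1.
Proof.
move=> k0 x0; rewrite weight_sum_rec ler_wpM2l // (bigD1 (Ordinal k0)) //=.
rewrite mul1r subn0 lerDl sumr_ge0 // => j _.
by rewrite mulr_ge0 ?weight_sum_ge0.
Qed.

Lemma weight_sum_gt0 k x n : (0 < k)%N -> 0 < x -> 0 < weight_sum k x n.
Proof.
move=> k0 x0; elim: n => [|n IH]; first by rewrite weight_sumE0.
have := @weight_sum_ge_pred k x n k0 (ltW x0).
move=> /(lt_le_trans (mulr_gt0 x0 IH)); by rewrite pmulr_rgt0.
Qed.

(** At x = n, each step from m to m+1 <= n multiplies the sum by at least n/(m+1) >= 1. This is the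
    right endpoint for the intermediate value theorem. *)
Lemma weight_sum_ge1 k n : (0 < k)%N -> 1 <= weight_sum k (n%:R : F) n.
Proof.
move=> k0; suff: forall m, (m <= n)%N -> 1 <= weight_sum k (n%:R : F) m by apply.
elim=> [|m IH] mn; first by rewrite weight_sumE0.
have := @weight_sum_ge_pred k n%:R m k0 (ler0n F n).
move=> h; rewrite -(ler_pM2l (ltr0Sn F m)) mulr1; apply: le_trans h.
rewrite -[leLHS]mulr1; apply: ler_pM => //; last exact/IH/ltnW.
by rewrite ler_nat.
Qed.

Lemma ler_weight_sum k n :
  {in Num.nneg &, {homo (fun x => weight_sum k x n) : x y / x <= y}}.
Proof.
move=> x y x0 y0 xy; apply: ler_sum => t _; rewrite ler_wpM2r ?invr_ge0 //.
by rewrite lerXn2r.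
Qed.

(** Strictness comes from the factor x of the recurrence; the sum it multiplies is positive and
    weakly increasing. *)
Lemma ltr_weight_sum k n x y : (0 < k)%N -> 0 < x -> x < y ->
  weight_sum k x n.+1 < weight_sum k y n.+1.
Proof.
move=> k0 x0 xy; have y0 := lt_trans x0 xy.
rewrite -(ltr_pM2l (ltr0Sn F n)) !weight_sum_rec.
apply: (@lt_le_trans _ _
  (y * \sum_(j < k | (j <= n)%N) j.+1%:R * weight_sum k x (n - j))).
  rewrite ltr_pM2r // (bigD1 (Ordinal k0)) //= ltr_wpDr //.
    by apply: sumr_ge0 => j _; rewrite mulr_ge0 ?weight_sum_ge0 // ltW.
  by rewrite mulr_gt0 ?weight_sum_gt0.
rewrite ler_pM2l //; apply: ler_sum => j _; rewrite ler_pM2l ?ltr0Sn //.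
by apply: ler_weight_sum; rewrite ?nnegrE ltW.
Qed.

Lemma weight_sum_le1 k x n : 0 <= x <= 1 ->
  (forall m, (m <= k ^ 2)%N -> weight_sum k x m <= 1) -> weight_sum k x n <= 1.
Proof.
move=> /andP[x0 x1] small; elim/ltn_ind: n => -[|n] IH; first by rewrite weight_sumE0.
have [/small//|kn] := leqP n.+1 (k ^ 2).
rewrite -(ler_pM2l (ltr0Sn F n)) mulr1 weight_sum_rec.
(* There are at most k terms, each at most k, and k^2 < n+1. *)
apply: (@le_trans _ _ (\sum_(j < k) k%:R)); last first.
  by rewrite sumr_const card_ord -mulrnA ler_nat mulnn ltnW.
apply: le_trans
  (_ : \sum_(j < k | (j <= n)%N) j.+1%:R * weight_sum k x (n - j) <= _).
  by rewrite ler_piMl ?sumr_ge0 // => j _; rewrite mulr_ge0 ?weight_sum_ge0.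
rewrite big_mkcond /=; apply: ler_sum => j _; case: ifP => // jn.
rewrite -[leRHS]mulr1 ler_pM ?weight_sum_ge0 ?ler_nat //.
by apply: IH; rewrite ltnS leq_subr.
Qed.

(** * Comparison of orders k and k+1, and growth below the order *)

Lemma coef_trunc_exp_ge0 x N j n : 0 <= x -> 0 <= (trunc_exp x N j)`_n.
Proof.
move=> x0; rewrite coef_sum sumr_ge0 // => a _.
by rewrite coefZ coefXn mulr_ge0 ?ler0n // divr_ge0 ?exprn_ge0.
Qed.

Lemma coef0_trunc_exp x N j : (trunc_exp x N j)`_0 = 1.
Proof.
rewrite coef_trunc_exp // /trunc_exp big_ord1 muln0 coefZ coefXn.
by rewrite expr0 fact0 divr1 mulr1.
Qed.

Lemma coef_trunc_exp_eq0 x N j n : (0 < n <= j)%N -> (trunc_exp x N j)`_n = 0.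
Proof.
move=> /andP[n0 nj]; rewrite coef_sum big1 // => a _; rewrite coefZ coefXn.
case: eqP => [na|]; last by rewrite mulr0.
case: (a : nat) na => [|b] na; first by rewrite na muln0 in n0.
by move: nj; rewrite na mulnS leqNgt addSn ltnS leq_addr.
Qed.

Lemma weight_sum_succ_le k x n : (n <= k)%N ->
  weight_sum k.+1 x n = weight_sum k x n.
Proof.
move=> nk; rewrite weight_sum_recr big_ord_recl subn0 coef0_trunc_exp mulr1.
rewrite big1 ?addr0 // => i _; rewrite coef_trunc_exp_eq0 ?mulr0 //=.
exact: leq_trans nk.
Qed.

Lemma weight_sum_succ_gt k x n : (0 < k < n)%N -> 0 < x ->
  weight_sum k x n < weight_sum k.+1 x n.
Proof.
move=> /andP[k0 kn] x0; rewrite weight_sum_recr.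
rewrite big_ord_recl subn0 coef0_trunc_exp mulr1 ltrDl.
(* After the shift by one, index k is degree k+1: the tuples with a single part k+1. *)
rewrite (bigD1 (Ordinal kn)) //= ltr_wpDr //.
  by apply: sumr_ge0 => j _; rewrite mulr_ge0 ?weight_sum_ge0 ?coef_trunc_exp_ge0 // ltW.
rewrite mulr_gt0 ?weight_sum_gt0 // /bump add1n coef_sum.
have n0 : (1 < n.+1)%N by rewrite ltnS (leq_ltn_trans _ kn).
rewrite (bigD1 (Ordinal n0)) //= muln1 coefZ coefXn eqxx mulr1 factS fact0 divr1 expr1.
rewrite ltr_wpDr // sumr_ge0 // => a _; rewrite coefZ coefXn mulr_ge0 ?ler0n //.
by rewrite divr_ge0 ?exprn_ge0 // ltW.
Qed.

(* Below the order, the recurrence telescopes into [(n+2) d_(n+1) = n d_n + x g_(n+1)],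
   where [g] is the weight sum and [d_n = g_(n+1) - g_n]. *)
Lemma weight_sum_second_diff k x n : (n.+1 < k)%N ->
  n.+2%:R * (weight_sum k x n.+2 - weight_sum k x n.+1) =
  n%:R * (weight_sum k x n.+1 - weight_sum k x n) + x * weight_sum k x n.+1.
Proof.
have full m : (m < k)%N -> m.+1%:R * weight_sum k x m.+1 =
    x * \sum_(i < m.+1) (m.+1 - i)%:R * weight_sum k x i.
  move=> mk; rewrite weight_sum_rec; congr (_ * _).
  rewrite -(big_ord_widen k (fun j => j.+1%:R * weight_sum k x (m - j)) mk).
  rewrite (reindex_inj rev_ord_inj) /=; apply: eq_bigr => i _.
  by rewrite subSS subKn ?subSn // -ltnS.
(* Passing from m to m+1 raises every coefficient in [full] by one, so subtraction leaves a plain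
   sum. *)
have diff m : (m.+1 < k)%N ->
    m.+2%:R * weight_sum k x m.+2 - m.+1%:R * weight_sum k x m.+1 =
    x * \sum_(i < m.+2) weight_sum k x i.
  move=> mk; rewrite !full ?(ltnW mk) // -mulrBr; congr (_ * _).
  rewrite big_ord_recr [in RHS]big_ord_recr /= addrAC -sumrB subSnn mul1r.
  congr (_ + _); apply: eq_bigr => i _.
  by rewrite -mulrBl subSn -?natrB ?leqnSn ?subSnn ?mul1r // ltnW.
case: n => [|n] nk.
  have := diff _ nk; rewrite !big_ord_recr big_ord0 /=.
  have := full 0%N (ltnW nk); rewrite big_ord1 => f d.
  by move: f d; rewrite /= subn0 !mul1r => f d; lra.
have := diff _ nk; have := diff _ (ltnW nk).
rewrite (big_ord_recr n.+2) /= mulrDr => <-.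
rewrite -!natr1 => d; lra.
Qed.

Lemma weight_sum_ltS k x n : (0 < n < k)%N -> 0 < x ->
  weight_sum k x n < weight_sum k x n.+1.
Proof.
move=> /andP[]; case: n => // n _ + x0; rewrite -subr_gt0; elim: n => [|n IH] nk.
  (* The factor n = 0 removes g_k(1) - g_k(0), whose sign is unknown. *)
  rewrite -(pmulr_rgt0 _ (ltr0Sn F 1)) weight_sum_second_diff //.
  by rewrite mul0r add0r mulr_gt0 ?weight_sum_gt0 // (ltn_trans _ nk).
rewrite -(pmulr_rgt0 _ (ltr0Sn F n.+2)) weight_sum_second_diff //.
rewrite ltr_wpDl ?mulr_gt0 ?weight_sum_gt0 // ?(ltn_trans _ nk) //.
by rewrite mulr_ge0 // ltW // IH // ltnW.
Qed.

Lemma weight_sum_succ_gt1 k x m : (0 < k)%N -> (0 < m)%N -> 0 < x ->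
  weight_sum k x m = 1 -> exists n, 1 < weight_sum k.+1 x n.
Proof.
move=> k0 m0 x0 gm; have [mk|km] := leqP m k; last first.
  by exists m; rewrite -gm weight_sum_succ_gt ?k0.
by exists m.+1; rewrite -gm -(weight_sum_succ_le k x m mk) weight_sum_ltS ?m0.
Qed.
End Order.

(** * Existence and uniqueness of the double mode *)

Lemma weight_sum_root (F : rcfType) (k n : nat) : (0 < k)%N -> (0 < n)%N ->
  exists2 x : F, 0 < x & weight_sum k x n = 1.
Proof.
move=> k0; case: n => // n _.
(* Here the polynomial variable is the parameter x, no longer z. *)
pose p : {poly F} := \sum_(t : {ffun 'I_k -> 'I_n.+2} | poisson_weight t == n.+1)
    ((\prod_(j < k) (t j)`!)%N%:R)^-1 *: 'X^(\sum_(j < k) t j)%N.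
have pE x : p.[x] = weight_sum k x n.+1.
  rewrite horner_sum; apply: eq_bigr => t _.
  by rewrite hornerZ hornerXn mulrC.
have p0 : p.[0] = 0.
  have : n.+1%:R * p.[0] = 0 by rewrite pE weight_sum_rec mul0r.
  by move/eqP; rewrite mulf_eq0 pnatr_eq0 /= => /eqP.
have [|x /andP[x0 _]] := @Num.Theory.poly_ivt F (p - 1) 0 n.+1%:R (ler0n _ _).
  by rewrite !hornerE p0 pE sub0r lerN10 subr_ge0 weight_sum_ge1.
rewrite /root !hornerE subr_eq0 pE => /eqP gx; exists x => //.
rewrite lt_neqAle x0 andbT; apply/eqP => x00.
by move: gx; rewrite -x00 -pE p0 => /eqP; rewrite eq_sym oner_eq0.
Qed.

Section Modes.
Context {R : realType}.
Implicit Types (x : R) (k : nat).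

Lemma poisson_pmf_le k x m n :
  (* unqualified, [poisson_pmf] is the mass function of mathcomp-analysis *)
  (Defs.poisson_pmf k x m <= Defs.poisson_pmf k x n) =
  (weight_sum k x m <= weight_sum k x n).
Proof. by rewrite ler_pM2l ?expR_gt0. Qed.

Lemma is_mode0 k x : is_mode k x 0 <-> forall n, weight_sum k x n <= 1.
Proof.
by split=> h n; have := h n; rewrite poisson_pmf_le weight_sumE0.
Qed.

Lemma double_modesP k x : double_modes R k x <->
  [/\ 0 < x, forall n, weight_sum k x n <= 1 &
    exists2 m, (0 < m)%N & weight_sum k x m = 1].
Proof.
split=> [[x0 /is_mode0 le1 [m m0 hm]]|[x0 le1 [m m0 gm]]].
  split=> //; exists m => //.
  by apply/eqP; rewrite eq_le le1 -(weight_sumE0 k x) -poisson_pmf_le hm.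
split=> //; first exact/is_mode0.
by exists m => // n; rewrite poisson_pmf_le gm.
Qed.

Lemma double_modes_lt k x y m :
  double_modes R k x -> 0 < y -> 1 < weight_sum k y m -> x < y.
Proof.
move=> /double_modesP[x0 le1 _] y0 gt1; rewrite ltNge; apply/negP => yx.
have : weight_sum k y m <= weight_sum k x m.
  by apply: ler_weight_sum => //; rewrite nnegrE ltW.
by rewrite leNgt (le_lt_trans (le1 m) gt1).
Qed.

(** At a smaller double mode y some sum equals 1, so by strict monotonicity it would exceed 1 at
    x. *)
Lemma double_modes_lbound k x : (0 < k)%N ->
  double_modes R k x -> lbound (double_modes R k) x.
Proof.
move=> k0 xD y /double_modesP[y0 _ [[//|m] m0 gm]]; rewrite leNgt; apply/negP => yx.
have /double_modesP[_ le1 _] := xD.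
by have := ltr_weight_sum k m y x k0 y0 yx; rewrite gm ltNge le1.
Qed.

Lemma double_modes_nonempty k : (0 < k)%N -> exists x, double_modes R k x.
Proof.
move=> k0.
(* The premise sits under the existential so that roots can be chosen for all n, with the dummy 0 at
   n = 0. *)
have root_ex n : exists x : R, (0 < n)%N -> 0 < x /\ weight_sum k x n = 1.
  case: n => [|n]; first by exists 0.
  by have [x x0 gx] := @weight_sum_root R k n.+1 k0 isT; exists x.
pose r n := sval (cid (root_ex n)).
have rP n : (0 < n)%N -> 0 < r n /\ weight_sum k (r n) n = 1 := svalP (cid (root_ex n)).
pose N := (k ^ 2)%N.
have N1 : (1 < N.+1)%N by rewrite ltnS expn_gt0 k0.
pose i1 : 'I_N.+1 := Ordinal N1.
have [m m0 mmin] := @arg_minP _ _ _ i1 (fun i : 'I_N.+1 => (0 < i)%N) (fun i => r i) isT.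
have [rm0 gm] := rP m m0.
exists (r m); apply/double_modesP; split=> //; last by exists m.
have le_root n : (0 < n <= N)%N -> weight_sum k (r m) n <= 1.
  move=> /andP[n0 nN]; have [rn0 <-] := rP n n0.
  apply: ler_weight_sum; rewrite ?nnegrE; [exact: ltW|exact: ltW|].
  exact: (mmin (Ordinal (nN : (n < N.+1)%N))).
(* The index 1 is among those minimized over, and x <= g_k(1). *)
have rm1 : r m <= 1.
  have := @weight_sum_ge_pred R k (r m) 0 k0 (ltW rm0).
  by rewrite weight_sumE0 mulr1 mul1r => /le_trans; apply; rewrite le_root.
move=> n; apply: weight_sum_le1; first by rewrite ltW.
by move=> [|i] iN; rewrite ?weight_sumE0 ?le_root.
Qed.

(** Any double mode is already the smallest, so existence keeps [xget] from its default. *)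
Lemma hat_lambda_smallest k : (0 < k)%N ->
  is_smallest (double_modes R k) (hat_lambda R k).
Proof.
move=> k0; have [x xD] := double_modes_nonempty k k0.
apply: (@xgetPex R 0 [set x | is_smallest (double_modes R k) x]%classic).
by exists x; split=> //; exact: double_modes_lbound.
Qed.
End Modes.

Theorem mainTheorem3 (R : realType) :
  (forall k : nat, (2 <= k)%N ->
     is_smallest (double_modes R k) (hat_lambda R k)) /\
  (forall k : nat, (2 <= k)%N -> hat_lambda R k.+1 < hat_lambda R k).
Proof.
split=> k /ltnW k0; first exact: hat_lambda_smallest.
have [/double_modesP[x0 _ [m m0 gm]] _] := @hat_lambda_smallest R k k0.
have [n gn] := weight_sum_succ_gt1 k _ m k0 m0 x0 gm.
by apply: (double_modes_lt _ _ _ _ _ x0 gn); case: (@hat_lambda_smallest R k.+1 isT).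
Qed.
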